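(* Let $M$ be an irreducible affine algebraic monoid over an algebraically closed field $\Bbbk$, with unit group $G$, and let $H\subset G$ be a closed subgroup that is observable in $M$. Then: (1) $H$ is observable in $G$. (2) $H$ is closed in $M$. (3) $\bigl[\Bbbk[M]\bigr]^H=\bigl[\Bbbk[G]\bigr]^H=\bigl[\Bbbk[G]^H\bigr]=\bigl[\Bbbk[M]^H\bigr]$. (4) The subgroup $H$ satisfies $$H=\bigl\{x\in G : f\cdot x=f\ \ \forall f\in\Bbbk[G]^H\bigr\}=\bigl\{x\in G : f\cdot x=f\ \ \forall f\in\Bbbk[M]^H\bigr\}=\bigl\{x\in M : f\cdot x=f\ \ \forall f\in\Bbbk[M]^H\bigr\}^0 .$$
   Context: An algebraic monoid is an algebraic variety $M$ with an associative product $M\times M\to M$ that is a morphism of varieties and has a neutral element $1$. Its unit group $G=G(M)$ (the set of invertible elements) is an algebraic group, open in $M$. $\Bbbk[X]$ denotes the algebra of regular functions on an affine variety $X$. For $f\in\Bbbk[M]$ and $x\in M$ put $(f\cdot x)(m)=f(xm)$, and likewise for $f\in\Bbbk[G]$, $x\in G$. A subgroup $H\subset G$ acts in this way on $\Bbbk[M]$ and $\Bbbk[G]$, and $(\ )^H$ denotes $H$-invariants. An action of an affine algebraic group $H$ on an affine variety $X$ is observable if every nonzero $H$-stable ideal $I\subset\Bbbk[X]$ satisfies $I^H\neq(0)$. A closed subgroup $H\subset G$ is observable in $M$ (resp. observable in $G$) if the action of $H$ on $M$ (resp. on $G$) by left multiplication is observable. For an integral domain $A$, $[A]$ denotes its field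 of fractions. Thus $\bigl[\Bbbk[M]\bigr]=\Bbbk(M)$, $\bigl[\Bbbk[M]\bigr]^H$ is the field of $H$-invariant rational functions on $M$, and $\bigl[\Bbbk[M]^H\bigr]$ is the field of fractions of the algebra of invariants. For an algebraic monoid $N$, $N^0$ denotes the unique irreducible component of $N$ containing $1$.
   Formalization: In (4) the last equality H={x∈M: f·x=f ∀f∈k[M]^H}^0, false for disconnected H (e.g. H={±1} in M=k, char≠2), is replaced by H={x∈M: f·x=f ∀f∈k[M]^H} for every H, plus the printed equality when H is irreducible. *)

(* Defs.v *)
From HB Require Import structures.
From mathcomp Require Import all_boot all_order all_algebra fraction mpoly.
From mathcomp Require Import boolp classical_sets functions.

Set Implicit Arguments.
Unset Strict Implicit.
Unset Printing Implicit Defensive.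

Import GRing.Theory.
Local Open Scope ring_scope.
Local Open Scope classical_set_scope.

(* Zariski topology on a set T of points with coordinates c : T -> k^n. *)
Definition zariski_closed (k : closedFieldType) (n : nat) (T : Type)
    (c : T -> 'rV[k]_n) (A : set T) : Prop :=
  exists S : set {mpoly k[n]},
    A = [set x | forall p, S p -> p.@[c x ord0] = 0].

Definition irreducible_set (k : closedFieldType) (n : nat) (T : Type)
    (c : T -> 'rV[k]_n) (A : set T) : Prop :=
  A !=set0 /\
  forall Z1 Z2 : set T, zariski_closed c Z1 -> zariski_closed c Z2 ->
    A `<=` Z1 `|` Z2 -> A `<=` Z1 \/ A `<=` Z2.

(* C is an irreducible component of N, i.e. a maximal irreducible subset,
   and it is the only one that contains e. *)
Definition component (k : closedFieldType) (n : nat) (T : Type)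
    (c : T -> 'rV[k]_n) (N C : set T) : Prop :=
  [/\ C `<=` N, irreducible_set c C &
      forall D, D `<=` N -> irreducible_set c D -> C `<=` D -> D = C].

Definition unique_component_at (k : closedFieldType) (n : nat) (T : Type)
    (c : T -> 'rV[k]_n) (e : T) (N C : set T) : Prop :=
  [/\ component c N C, C e & forall D, component c N D -> D e -> D = C].

(* An affine variety is a Zariski-closed subset of some k^n; here it is the
   bijective image of the carrier of an abstract monoid. *)
Record irr_affine_monoid (k : closedFieldType) := IrrAffineMonoid {
  iam_carrier :> monoidType;
  iam_dim : nat;
  iam_coord : iam_carrier -> 'rV[k]_iam_dim;
  iam_coord_inj : injective iam_coord;
  iam_coord_closed : zariski_closed id (range iam_coord);
  iam_mul_morphism :
    exists mu : 'I_iam_dim -> {mpoly k[iam_dim + iam_dim]},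
    forall x y : iam_carrier,
      iam_coord (x * y)%g =
      \row_i (mu i).@[row_mx (iam_coord x) (iam_coord y) ord0];
  iam_irreducible : irreducible_set iam_coord setT
}.

Local Notation "x %:F" := (@FracField.tofrac _ x).

Section CoordinateRing.
Variables (k : closedFieldType) (M : irr_affine_monoid k).

Definition polynomial_fun (f : M -> k) : Prop :=
  exists p : {mpoly k[iam_dim M]}, forall x, f x = p.@[iam_coord x ord0].

Definition polynomial_funb : {pred M -> k} := fun f => `[< polynomial_fun f >].

(* The algebra k[M]: as M is closed in k^n, its regular functions are the
   restrictions of polynomials. *)
Record kM := KM { kM_fun :> M -> k; kM_funP : kM_fun \in polynomial_funb }.

HB.instance Definition _ := [isSub for kM_fun].
HB.instance Definition _ := [Choice of kM by <:].

Lemma polynomial_fun_subring : subring_closed polynomial_funb.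
Proof.
split.
- by apply/asboolP; exists 1 => x; rewrite meval1.
- move=> f g /asboolP[p fp] /asboolP[q gq]; apply/asboolP; exists (p - q) => x.
  by rewrite mevalB -fp -gq.
- move=> f g /asboolP[p fp] /asboolP[q gq]; apply/asboolP; exists (p * q) => x.
  by rewrite mevalM -fp -gq.
Qed.

HB.instance Definition _ :=
  GRing.SubChoice_isSubComPzRing.Build (M -> k) polynomial_funb kM
    polynomial_fun_subring.

Lemma kM_eqP (f g : kM) : f =1 g -> f = g.
Proof. by move=> fg; apply/val_inj/funext. Qed.

Lemma kM_neq0P (f : kM) : f <> 0 -> exists x, f x <> 0.
Proof.
move=> f0; apply: contrapT => nf; apply: f0; apply: kM_eqP => x.
by apply: contrapT => fx; apply: nf; exists x.
Qed.

Lemma kM_oner_neq0 : (1 : kM) != 0.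
Proof.
apply/eqP => /(congr1 (fun f : kM => f 1%g)).
by move/eqP; apply/negP; exact: oner_neq0.
Qed.

HB.instance Definition _ := GRing.PzSemiRing_isNonZero.Build kM kM_oner_neq0.

Definition kM_unit : {pred kM} := fun f => `[< exists g : kM, g * f = 1 >].

Definition kM_inv (f : kM) : kM :=
  if pselect (exists g : kM, g * f = 1) is left e then projT1 (cid e) else f.

Lemma kM_mulVf : {in kM_unit, left_inverse 1 kM_inv *%R}.
Proof.
move=> f /asboolP ef; rewrite /kM_inv.
by case: pselect => // e; exact: (projT2 (cid e)).
Qed.

Lemma kM_unitP (f g : kM) : g * f = 1 -> kM_unit f.
Proof. by move=> gf; apply/asboolP; exists g. Qed.

Lemma kM_inv_out : {in [predC kM_unit], kM_inv =1 id}.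
Proof.
move=> f; rewrite inE /= => /asboolP nf; rewrite /kM_inv.
by case: pselect.
Qed.

HB.instance Definition _ :=
  GRing.ComNzRing_hasMulInverse.Build kM kM_mulVf kM_unitP kM_inv_out.

Lemma zariski_closed_kM0 (f : kM) :
  zariski_closed (@iam_coord k M) [set x | f x = 0].
Proof.
case: f => f /= /asboolP[p fp]; exists [set p]; apply/seteqP.
by split=> x /=; rewrite fp; [move=> px _ -> | apply].
Qed.

Lemma kM_integral : GRing.integral_domain_axiom kM.
Proof.
move=> f g fg.
have [|Z|Z] := (iam_irreducible M).2 [set x | f x = 0] [set x | g x = 0]
  (zariski_closed_kM0 f) (zariski_closed_kM0 g).
- move=> x _ /=; have /eqP : f x * g x = 0.
    by rewrite -[LHS]/((f * g) x) fg.
  by rewrite mulf_eq0 => /orP[/eqP|/eqP]; [left|right].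
- by apply/orP; left; apply/eqP/kM_eqP => x; exact: Z.
- by apply/orP; right; apply/eqP/kM_eqP => x; exact: Z.
Qed.

HB.instance Definition _ := GRing.ComUnitRing_isIntegral.Build kM kM_integral.

End CoordinateRing.

Arguments kM {k} M.

Section Action.
Variables (k : closedFieldType) (M : irr_affine_monoid k).
Implicit Types (x y : M) (f : kM M).

Lemma translate_subproof x f :
  (fun m => f (x * m)%g) \in polynomial_funb (M := M).
Proof.
case: f => f /= /asboolP[p fp]; apply/asboolP.
have [mu muE] := iam_mul_morphism M.
pose Xs (i : 'I_(iam_dim M + iam_dim M)) : {mpoly k[iam_dim M]} :=
  match fintype.split i with inl j => (iam_coord x ord0 j)%:MP | inr j => 'X_j end.
pose X := [tuple Xs i | i < iam_dim M + iam_dim M].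
exists (p \mPo [tuple mu i \mPo X | i < iam_dim M]) => m.
rewrite fp comp_mpoly_meval muE; apply: meval_eq => i.
rewrite tnth_mktuple comp_mpoly_meval mxE; apply: meval_eq => j.
rewrite tnth_mktuple /Xs mxE; case: fintype.split => l.
  by rewrite mevalC.
by rewrite mevalXU.
Qed.

(* f . x, that is, (f . x) m = f (x m). *)
Definition translate x f : kM M := KM (translate_subproof x f).

(* z . x for z in k(M), obtained by translating numerator and denominator of z.
   By [frac_translateE] this is the induced action of the unit group on k(M); it
   is not meaningful for other x, where the translate of a denominator can
   vanish. *)
Definition frac_translate x (z : {fraction kM M}) : {fraction kM M} :=
  (translate x \n_(repr z))%:F / (translate x \d_(repr z))%:F.

Definition unit_group : set M := [set x | exists y, (x * y = 1 /\ y * x = 1)%g].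

Lemma translateM x f g : translate x (f * g) = translate x f * translate x g.
Proof. exact: kM_eqP. Qed.

Lemma translate_inj x : unit_group x -> injective (translate x).
Proof.
move=> [y [xy _]] f g fg; apply: kM_eqP => m.
by have := congr1 (fun h : kM M => h (y * m)%g) fg; rewrite /= mulgA xy mul1g.
Qed.

Lemma frac_reprE (z : {fraction kM M}) : z = (\n_(repr z))%:F / (\d_(repr z))%:F.
Proof.
rewrite -{1}[z]reprK; set r := repr z; unlock FracField.tofrac.
rewrite -[X in _ = _ * X]FracField.pi_inv -[RHS]FracField.pi_mul.
rewrite /FracField.mulf /FracField.invf !numden_Ratio ?oner_neq0 ?mulr1 ?mul1r ?denom_ratioP //.
by rewrite Ratio_numden.
Qed.

Lemma frac_translateE x (a b : kM M) : unit_group x -> b != 0 ->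
  frac_translate x (a%:F / b%:F) = (translate x a)%:F / (translate x b)%:F.
Proof.
move=> Gx b0; set z := _ / _ : {fraction kM M}; rewrite /frac_translate.
have tn0 c : c != 0 -> (translate x c)%:F != 0.
  apply: contra_neq => /eqP; rewrite tofrac_eq0 => /eqP tc.
  by apply: (translate_inj Gx); rewrite tc; exact/esym/kM_eqP.
apply/eqP; rewrite eqr_div ?tn0 ?denom_ratioP // -!tofracM -!translateM tofrac_eq.
apply/eqP; congr translate; apply/eqP.
rewrite -tofrac_eq !tofracM -eqr_div ?tofrac_eq0 ?denom_ratioP //.
by apply/eqP; rewrite -frac_reprE.
Qed.

Definition closed_subgroup (H : set M) : Prop :=
  [/\ H `<=` unit_group, H 1%g, forall x y, H x -> H y -> H (x * y)%g,
      forall x y, H x -> (x * y = 1 /\ y * x = 1)%g -> H y &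
      exists2 Z : set M, zariski_closed (@iam_coord k M) Z &
        H = unit_group `&` Z].

(* The algebra k[G] of the open subset G of M, as the subring of k(M) = k(G)
   of the rational functions that are regular at each point of G. *)
Definition kG : set {fraction kM M} :=
  [set z | forall x, unit_group x ->
     exists a b : kM M, b x <> 0 /\ z = a%:F / b%:F].

End Action.

Section Observable.
Variables (T : Type) (R : nzRingType) (A : set R) (act : T -> R -> R).

Definition invariants (H : set T) : set R :=
  [set f | A f /\ forall x, H x -> act x f = f].

(* A is a subring of R, and I an ideal of A. *)
Definition ideal_of (I : set R) : Prop :=
  [/\ I `<=` A, I 0, forall f g, I f -> I g -> I (f + g) &
      forall a f, A a -> I f -> I (a * f)].

Definition observable (H : set T) : Prop :=
  forall I : set R, ideal_of I ->
    (forall x f, H x -> I f -> I (act x f)) ->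
    (exists2 f, I f & f <> 0) ->
    exists f, [/\ I f, f <> 0 & forall x, H x -> act x f = f].

End Observable.

(* The field of fractions of a subring A of a field. *)
Definition fractions (F : fieldType) (A : set F) : set F :=
  [set z | exists a b, [/\ A a, A b, b <> 0 & z = a / b]].

Section ObservableSubgroup.
Variables (k : closedFieldType) (M : irr_affine_monoid k) (H : set M).

Definition observable_in_M : Prop := observable setT (@translate k M) H.

Definition observable_in_G : Prop := observable (@kG k M) (@frac_translate k M) H.

Definition kM_inv_ring : set (kM M) := invariants setT (@translate k M) H.

Definition kG_inv_ring : set {fraction kM M} :=
  invariants (@kG k M) (@frac_translate k M) H.

End ObservableSubgroup.

(* Main.v *)
Require Import Defs.
From HB Require Import structures.
From mathcomp Require Import all_boot all_order all_algebra fraction mpoly.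
From mathcomp Require Import boolp classical_sets functions.
Local Open Scope ring_scope.
Local Open Scope classical_set_scope.
Import Order.TTheory GRing.Theory Num.Theory.

Set Implicit Arguments.
Unset Strict Implicit.
Unset Printing Implicit Defensive.

(* The span of the left translates of the coordinate functions is finite
   dimensional, which represents M by matrices; the unit group is the set where
   the determinant of this representation is nonzero.

   Observability is used three times, each time through an explicit H-stable
   ideal. The denominators of an H-invariant rational function contain a nonzero
   invariant, so k(M)^H is the field of fractions of k[M]^H. The contraction to
   k[M] of an ideal of k[G] is nonzero, so H is observable in G. The functions
   vanishing outside G contain a nonzero invariant f; if x fixes k[M]^H, then
   f(xm) = f(m) <> 0 for some m, so that x is a unit.

   Finally, for x in G not in H, some f vanishes on H but not at x. Choosing a
   basis of the span of the H-translates of f and evaluating it at enough points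
   gives a Cramer quotient in k(M)^H that x does not fix. Hence H is the fixer of
   k[M]^H in M, which is closed. *)

(** * Kernels of finite rank over a field *)

Section FiniteRank.
Variables (k : fieldType) (S T : Type).
Implicit Types F G : S -> T -> k.

(** For [F s t = f (s * t)] this says that the translates of [f] span a finite-dimensional space. *)
Definition finite_rank F : Prop :=
  exists (I : finType) (a : S -> I -> k) (b : I -> T -> k),
    forall s t, F s t = \sum_i a s i * b i t.

Lemma finite_rank_eq F G : (forall s t, F s t = G s t) ->
  finite_rank F -> finite_rank G.
Proof. by move=> FG [I [a [b E]]]; exists I, a, b => s t; rewrite -FG. Qed.

Lemma finite_rank_mulf (f : S -> k) (g : T -> k) :
  finite_rank (fun s t => f s * g t).
Proof.
exists unit, (fun s _ => f s), (fun _ t => g t) => s t.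
by rewrite (big_pred1 tt) // => -[].
Qed.

Lemma finite_rank_l (f : S -> k) : finite_rank (fun s _ => f s).
Proof.
apply: (finite_rank_eq _ (finite_rank_mulf f (fun=> 1))) => s t.
by rewrite mulr1.
Qed.

Lemma finite_rank_r (g : T -> k) : finite_rank (fun _ t => g t).
Proof.
apply: (finite_rank_eq _ (finite_rank_mulf (fun=> 1) g)) => s t.
by rewrite mul1r.
Qed.

Lemma finite_rankD F G : finite_rank F -> finite_rank G ->
  finite_rank (fun s t => F s t + G s t).
Proof.
move=> [I [a [b FE]]] [J [c [d GE]]].
exists (I + J)%type,
  (fun s ij => match ij with inl i => a s i | inr j => c s j end),
  (fun ij t => match ij with inl i => b i t | inr j => d j t end) => s t.
by rewrite big_sumType /= FE GE.
Qed.

Lemma finite_rankM F G : finite_rank F -> finite_rank G ->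
  finite_rank (fun s t => F s t * G s t).
Proof.
move=> [I [a [b FE]]] [J [c [d GE]]].
exists (I * J)%type, (fun s ij => a s ij.1 * c s ij.2),
  (fun ij t => b ij.1 t * d ij.2 t) => s t.
rewrite FE GE big_distrlr pair_bigA /=; apply: eq_bigr => -[i j] _ /=.
by rewrite mulrACA.
Qed.

Lemma finite_rank_sum (J : Type) (r : seq J) (F : J -> S -> T -> k) :
  (forall j, finite_rank (F j)) ->
  finite_rank (fun s t => \sum_(j <- r) F j s t).
Proof.
move=> FF; elim: r => [|j r IH].
  by apply: (finite_rank_eq _ (finite_rank_l (fun=> 0))) => s t; rewrite big_nil.
apply: (finite_rank_eq _ (finite_rankD (FF j) IH)) => s t.
by rewrite big_cons.
Qed.

Lemma finite_rank_prod (J : Type) (r : seq J) (F : J -> S -> T -> k) :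
  (forall j, finite_rank (F j)) ->
  finite_rank (fun s t => \prod_(j <- r) F j s t).
Proof.
move=> FF; elim: r => [|j r IH].
  by apply: (finite_rank_eq _ (finite_rank_l (fun=> 1))) => s t; rewrite big_nil.
apply: (finite_rank_eq _ (finite_rankM (FF j) IH)) => s t.
by rewrite big_cons.
Qed.

Lemma finite_rankX F e : finite_rank F -> finite_rank (fun s t => F s t ^+ e).
Proof.
move=> FF; elim: e => [|e IH].
  by apply: (finite_rank_eq _ (finite_rank_l (fun=> 1))) => s t; rewrite expr0.
by apply: (finite_rank_eq _ (finite_rankM FF IH)) => s t; rewrite exprS.
Qed.

Lemma finite_rank_meval n (p : {mpoly k[n]}) (F : S -> T -> 'I_n -> k) :
  (forall i, finite_rank (fun s t => F s t i)) ->
  finite_rank (fun s t => p.@[F s t]).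
Proof.
move=> FF; apply: (@finite_rank_eq (fun s t =>
    \sum_(m <- msupp p) p@_m * \prod_i F s t i ^+ m i)).
  by move=> s t; rewrite mevalE.
apply: finite_rank_sum => m; apply: finite_rankM; first exact: finite_rank_l.
by apply: finite_rank_prod => i; exact: finite_rankX.
Qed.

Definition kernel_mx F r r' (s : 'I_r -> S) (t : 'I_r' -> T) : 'M[k]_(r, r') :=
  \matrix_(i, j) F (s i) (t j).

(** Every kernel matrix factors through a space of dimension [#|I|], which bounds its rank. *)
Lemma finite_rank_bound F : finite_rank F ->
  exists L, forall r (s : 'I_r -> S) (t : 'I_r -> T),
    kernel_mx F s t \in unitmx -> (r <= L)%N.
Proof.
move=> [I [a [b FE]]]; exists #|I| => r s t.
rewrite -row_free_unit -row_leq_rank => /leq_trans; apply.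
pose A := \matrix_(i < r, l < #|I|) a (s i) (enum_val l).
pose B := \matrix_(l < #|I|, j < r) b (enum_val l) (t j).
suff -> : kernel_mx F s t = A *m B by exact: mulmx_max_rank.
apply/matrixP => i j; rewrite !mxE FE.
rewrite (reindex (@enum_val I (pred_of_simpl predT))) /=; last first.
  by exists (@enum_rank I) => l _; rewrite (enum_valK, enum_rankK).
by apply: eq_bigr => l _; rewrite !mxE.
Qed.

Lemma det_schur r (D : 'M[k]_r) (u : 'cV[k]_r) (v : 'rV[k]_r) (w : 'M[k]_1) :
  D \in unitmx ->
  \det (block_mx D u v w) = \det D * (w - v *m invmx D *m u) ord0 ord0.
Proof.
move=> Du; have -> : block_mx D u v w =
    block_mx 1%:M 0 (v *m invmx D) 1%:M *m
    block_mx D u 0 (w - v *m invmx D *m u).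
  rewrite mulmx_block !mul1mx !mul0mx !addr0 mulmxKV //.
  by rewrite addrC subrK.
by rewrite det_mulmx det_lblock det_ublock !det1 !mul1r [X in _ * X]det_mx11.
Qed.

(* A kernel of finite rank is reconstructed from a nonsingular minor of maximal
   size. *)
Lemma finite_rank_basis F : finite_rank F ->
  exists r (s : 'I_r -> S) (t : 'I_r -> T),
    kernel_mx F s t \in unitmx /\
    forall x y, F x y = (kernel_mx F (fun _ : 'I_1 => x) t *m
      invmx (kernel_mx F s t) *m kernel_mx F s (fun _ : 'I_1 => y)) ord0 ord0.
Proof.
move=> /finite_rank_bound[L bound].
pose P r := `[< exists (s : 'I_r -> S) (t : 'I_r -> T),
                  kernel_mx F s t \in unitmx >].
(* The empty minor has determinant 1, so a maximal size exists even when [F] is zero. *)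
have P0 : exists r, P r.
  have ord0_elim (U : Type) : 'I_0 -> U by case.
  exists 0%N; apply/asboolP; exists (@ord0_elim S), (@ord0_elim T).
  by rewrite unitmxE det_mx00 unitr1.
have PL r : P r -> (r <= L)%N by move=> /asboolP[s [t]]; exact: bound.
have [r /asboolP[s [t Du]] rmax] := ex_maxnP P0 PL.
exists r, s, t; split=> // x y.
(* Border the maximal minor by the row of [x] and the column of [y]. The larger minor is singular,
   so its Schur complement, the difference of the two sides, vanishes. *)
pose s' (i : 'I_(r + 1)) := if fintype.split i is inl l then s l else x.
pose t' (i : 'I_(r + 1)) := if fintype.split i is inl l then t l else y.
suff E : kernel_mx F s' t' = block_mx (kernel_mx F s t)
    (kernel_mx F s (fun _ : 'I_1 => y)) (kernel_mx F (fun _ : 'I_1 => x) t)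
    (F x y)%:M.
  have : ~~ P (r + 1)%N by apply/negP => /rmax; rewrite addn1 ltnn.
  move=> /asboolPn nP; apply: contrapT => Fxy; apply: nP; exists s', t'.
  rewrite E unitmxE det_schur // unitrM -unitmxE Du /= unitfE !mxE eqxx mulr1n.
  rewrite subr_eq0; apply/eqP; rewrite mxE in Fxy; exact: Fxy.
apply/matrixP => i j; rewrite !mxE /s' /t'.
by case: fintype.split => a; rewrite mxE; case: fintype.split => b;
  rewrite !mxE // !ord1 eqxx mulr1n.
Qed.

End FiniteRank.

Lemma finite_rank_comp (k : fieldType) (S S' T : Type) (h : S' -> S)
    (F : S -> T -> k) :
  finite_rank F -> finite_rank (fun s t => F (h s) t).
Proof. by move=> [I [a [b FE]]]; exists I, (a \o h), b => s t; exact: FE. Qed.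

Lemma int_lower_bound r (s : 'I_r -> int) :
  exists N : nat, forall i, 0 <= s i + N%:Z.
Proof.
exists (\sum_i `|s i|)%N => i.
rewrite (bigD1 i) //= PoszD addrA addr_ge0 //.
by rewrite abszE -lerBlDr sub0r lerNnormlW.
Qed.

(** The shifts of [a] span a finite-dimensional space on which the shift is invertible, so vanishing
    at nonnegative indices propagates to negative ones. *)
Lemma finite_rank_int_eq0 (k : fieldType) (a : int -> k) :
  finite_rank (fun s t : int => a (s + t)) -> (forall n : nat, a n%:Z = 0) ->
  forall s, a s = 0.
Proof.
move=> /finite_rank_basis[r [s [t [Du basis]]]] a0 x.
pose F (s t : int) := a (s + t); set D := kernel_mx _ s t in Du basis.
have [N sN] := int_lower_bound s; have [N' tN'] := int_lower_bound t.
(* This [n] makes every index [s i + n + t j] nonnegative. *)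
pose n : int := N%:Z + N'%:Z.
have D0 : kernel_mx F (fun i => s i + n) t = 0.
  apply/matrixP => i j; rewrite !mxE /F.
  have : 0 <= s i + n + t j.
    by have := addr_ge0 (sN i) (tN' j); rewrite addrACA addrAC.
  by case: (s i + n + t j) => // m _; exact: a0.
(* Shifting by n is invertible on the span of the translates of a. *)
have : D = kernel_mx F (fun i => s i - n) t *m invmx D *m
           kernel_mx F (fun i => s i + n) t.
  apply/matrixP => i j; rewrite mxE.
  have -> : s i + t j = (s i - n) + (n + t j) by rewrite addrA subrK.
  rewrite basis [in RHS]mxE mxE; apply: eq_bigr => l _; congr (_ * _).
    by rewrite !mxE; apply: eq_bigr => l' _; rewrite !mxE.
  by rewrite !mxE /F addrA.
rewrite D0 mulmx0 => DE.
have V0 : invmx D = 0 by rewrite -[LHS]mul1mx -(mulVmx Du) DE mulmx0 mul0mx.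
by rewrite -[x]addr0 basis V0 mulmx0 mul0mx mxE.
Qed.

(** * Evaluation, translations and finite rank on [k[M]] *)

Section Evaluation.
Variables (k : closedFieldType) (M : irr_affine_monoid k).
Local Open Scope group_scope.

(** Named so that evaluation carries a ring morphism structure and acts entrywise on matrices over
    [kM M]. *)
Definition kM_eval (m : M) (f : kM M) : k := f m.

Fact kM_eval_additive m : zmod_morphism (kM_eval m).
Proof. by []. Qed.

Fact kM_eval_multiplicative m : monoid_morphism (kM_eval m).
Proof. by []. Qed.

HB.instance Definition _ m :=
  GRing.isZmodMorphism.Build (kM M) k (kM_eval m) (kM_eval_additive m).
HB.instance Definition _ m :=
  GRing.isMonoidMorphism.Build (kM M) k (kM_eval m) (kM_eval_multiplicative m).

Fact translate_additive x : zmod_morphism (@translate k M x).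
Proof. by move=> f g; apply: kM_eqP. Qed.

Fact translate_multiplicative x : monoid_morphism (@translate k M x).
Proof. by split=> [|f g]; apply: kM_eqP. Qed.

HB.instance Definition _ x :=
  GRing.isZmodMorphism.Build (kM M) (kM M) (@translate k M x)
    (translate_additive x).
HB.instance Definition _ x :=
  GRing.isMonoidMorphism.Build (kM M) (kM M) (@translate k M x)
    (translate_multiplicative x).

Lemma rtranslate_subproof y (f : kM M) :
  (fun m => f (m * y)) \in polynomial_funb (M := M).
Proof.
case: f => f /= /asboolP[p fp]; apply/asboolP.
have [mu muE] := iam_mul_morphism M.
pose Xs (i : 'I_(iam_dim M + iam_dim M)) : {mpoly k[iam_dim M]} :=
  match fintype.split i with inl j => 'X_j | inr j => (iam_coord y ord0 j)%:MP end.
pose X := [tuple Xs i | i < iam_dim M + iam_dim M].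
exists (p \mPo [tuple mu i \mPo X | i < iam_dim M]) => m.
rewrite fp comp_mpoly_meval muE; apply: meval_eq => i.
rewrite tnth_mktuple comp_mpoly_meval mxE; apply: meval_eq => j.
rewrite tnth_mktuple /Xs mxE; case: fintype.split => l.
  by rewrite mevalXU.
by rewrite mevalC.
Qed.

Definition rtranslate y f : kM M := KM (rtranslate_subproof y f).

(** Each coordinate of [x * y] is a polynomial in kernels that depend on [x] alone or on [y]
    alone. *)
Lemma finite_rank_mul (p : {mpoly k[iam_dim M]}) :
  finite_rank (fun x y : M => p.@[iam_coord (x * y) ord0]).
Proof.
have [mu muE] := iam_mul_morphism M.
apply: (@finite_rank_meval _ _ _ _ p (fun x y => iam_coord (x * y) ord0)) => i.
apply: (@finite_rank_eq _ _ _ (fun x y : M =>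
    (mu i).@[row_mx (iam_coord x) (iam_coord y) ord0])) => [x y|].
  by rewrite muE mxE.
apply: (@finite_rank_meval _ _ _ _ (mu i)
  (fun x y => row_mx (iam_coord x) (iam_coord y) ord0)) => j.
case: (fintype.splitP j) => l jl.
  apply: finite_rank_eq (finite_rank_l _ (fun x : M => iam_coord x ord0 l)) => x y.
  have -> : j = lshift _ l by apply: val_inj.
  by rewrite row_mxEl.
apply: finite_rank_eq (finite_rank_r _ (fun y : M => iam_coord y ord0 l)) => x y.
have -> : j = rshift _ l by apply: val_inj.
by rewrite row_mxEr.
Qed.

Lemma finite_rank_kM (f : kM M) : finite_rank (fun x y : M => f (x * y)).
Proof.
case: f => f /= /asboolP[p fp].
by apply: finite_rank_eq (finite_rank_mul p) => x y; rewrite fp.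
Qed.

Lemma kM_of_poly (p : {mpoly k[iam_dim M]}) :
  exists f : kM M, forall x, f x = p.@[iam_coord x ord0].
Proof.
have pP : (fun x : M => p.@[iam_coord x ord0]) \in polynomial_funb (M := M).
  by apply/asboolP; exists p.
by exists (KM pP).
Qed.

Lemma coord_eq (x y : M) :
  (forall i, iam_coord x ord0 i = iam_coord y ord0 i) -> x = y.
Proof.
by move=> xy; apply: iam_coord_inj; apply/rowP.
Qed.

End Evaluation.

(** * Matrix representation of [M] and openness of its unit group *)

Section UnitGroup.
Variables (k : closedFieldType) (M : irr_affine_monoid k).
Local Open Scope group_scope.

(* The span of the left translates of the coordinate functions has a basis v
   given by translates of coordinates; M acts on it by rho. *)
Lemma matrix_representation :
  exists r (rho : M -> 'M[k]_r) (v : M -> 'cV[k]_r)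
      (c : 'I_(iam_dim M) -> 'rV[k]_r) (chi : kM M),
    [/\ rho 1 = 1%:M /\ (forall x y, rho (x * y) = rho x *m rho y),
        forall x y, v (x * y) = rho x *m v y,
        forall i x, iam_coord x ord0 i = (c i *m v x) ord0 ord0,
        forall a, exists q : kM M, forall x, v x a ord0 = q x &
        forall x, (rho x \in unitmx) = (chi x != 0)%R].
Proof.
(* The rows of this kernel are the left translates of all coordinates at once, so that one basis
   serves every coordinate. *)
pose F (s : 'I_(iam_dim M) * M) (y : M) : k := iam_coord (s.2 * y) ord0 s.1.
have Ffin : finite_rank F.
  apply: (@finite_rank_eq _ _ _ (fun s y =>
      \sum_i (s.1 == i)%:R * iam_coord (s.2 * y) ord0 i)%R) => [s y|].
    rewrite (bigD1 s.1) //= eqxx mul1r big1 ?addr0 // => i /negPf.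
    by rewrite eq_sym => ->; rewrite mul0r.
  apply: finite_rank_sum => i; apply: finite_rankM.
    exact: (finite_rank_l _ (fun s => (s.1 == i)%:R%R)).
  apply: (finite_rank_comp snd (F := fun x y => iam_coord (x * y) ord0 i)).
  apply: finite_rank_eq (finite_rank_mul 'X_i) => x y.
  by rewrite mevalXU.
have [r [s [t [Du basis]]]] := finite_rank_basis Ffin.
set D := kernel_mx F s t in Du basis.
pose sx x a := ((s a).1, (s a).2 * x).
pose Dx x := kernel_mx F (sx x) t.
pose rho x : 'M_r := Dx x *m invmx D.
pose v x := kernel_mx F s (fun _ : 'I_1 => x).
have D1 : Dx 1 = D.
  by apply/matrixP => a b; rewrite !mxE /F /= mulg1.
have shiftE x a y : F (s a) (x * y) = (rho x *m v y) a ord0.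
  have -> : F (s a) (x * y) = F (sx x a) y by rewrite /F /= mulgA.
  rewrite basis mxE [RHS]mxE; apply: eq_bigr => l _; congr (_ * _)%R.
  by rewrite !mxE; apply: eq_bigr => l' _; rewrite !mxE.
have DM x y : Dx (x * y) = rho x *m Dx y.
  apply/matrixP => a b; rewrite mxE.
  have -> : F (sx (x * y) a) (t b) = F (s a) (x * (y * t b)).
    by rewrite /F /= !mulgA.
  rewrite shiftE !mxE; apply: eq_bigr => l _; congr (_ * _)%R.
  by rewrite !mxE /F /= mulgA.
have q0 (i : 'I_(iam_dim M)) : exists f : kM M, forall x, f x = iam_coord x ord0 i.
  have [f fE] := kM_of_poly (M := M) 'X_i.
  by exists f => x; rewrite fE mevalXU.
have {q0} [f fE] := choice q0.
(* [DK] is [Dx] with its entries viewed as regular functions; its determinant is the [chi] that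
   tests invertibility of [rho x]. *)
pose DK : 'M[kM M]_r :=
  \matrix_(a, b) rtranslate (t b) (translate (s a).2 (f (s a).1)).
have DKE x : map_mx (kM_eval x) DK = Dx x.
  by apply/matrixP => a b; rewrite !mxE /kM_eval /= fE /F /= mulgA.
exists r, rho, v, (fun i => kernel_mx F (fun _ : 'I_1 => (i, 1)) t *m invmx D),
  (\det DK).
split.
- by split=> [|x y]; rewrite /rho ?D1 ?mulmxV // DM mulmxA.
- by move=> x y; apply/matrixP => a b; rewrite !ord1 mxE shiftE.
- move=> i x; have <- := basis (i, 1) x; by rewrite /F /= mul1g.
- move=> a; exists (translate (s a).2 (f (s a).1)) => x.
  by rewrite mxE /= fE.
- move=> x; have -> : (\det DK) x = \det (Dx x) by rewrite -DKE det_map_mx.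
  by rewrite -unitfE -unitmxE /rho unitmx_mul unitmx_inv Du andbT.
Qed.

(** As a function of an integer exponent, the difference of the two sides has finite rank because
    [A ^ (s + t)] is [A ^ s * A ^ t]. It vanishes at nonnegative exponents, hence at -1. *)
Lemma invmx_orbit_meval r n (A : 'M[k]_r.+1) (w : 'cV[k]_r.+1)
    (c : 'I_n -> 'rV[k]_r.+1) (e : 'rV[k]_r.+1) (p : {mpoly k[n]}) :
  A \is a GRing.unit ->
  (forall m : nat, p.@[fun i => (c i *m A ^+ m *m w)%R ord0 ord0] =
                   (e *m A ^+ m *m w)%R ord0 ord0) ->
  p.@[fun i => (c i *m A^-1 *m w)%R ord0 ord0] = (e *m A^-1 *m w)%R ord0 ord0.
Proof.
move=> Au pA; have entry l : finite_rank (fun s t : int =>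
    (l *m (A ^ (s + t)) *m w)%R ord0 ord0).
  exists 'I_r.+1, (fun s a => (l *m (A ^ s)%R) ord0 a),
    (fun a t => ((A ^ t)%R *m w) a ord0) => s t.
  by rewrite exprzDr // -[(_ * _)%R]/(_ *m _) mulmxA -mulmxA mxE.
pose a (m : int) : k :=
  (p.@[fun i => (c i *m (A ^ m) *m w) ord0 ord0] +
    - 1 * (e *m (A ^ m) *m w) ord0 ord0)%R.
have : a (-1)%R = 0%R.
  apply: finite_rank_int_eq0 => [|m].
    apply: finite_rankD; last by apply: finite_rankM => //; exact: finite_rank_l.
    apply: (@finite_rank_meval _ _ _ _ p
      (fun s t : int => fun i => (c i *m (A ^ (s + t)) *m w)%R ord0 ord0)) => i.
    exact: entry.
  by rewrite /a pA mulN1r subrr.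
by rewrite /a mulN1r => /eqP; rewrite subr_eq0 => /eqP.
Qed.

(* For x with rho x invertible, the point of k^n that should be x^-1 satisfies
   the equations of M: these hold along the powers rho x ^ s with s >= 0, hence
   also at s = -1. *)
Lemma unit_group_open : exists2 chi : kM M, chi 1 <> 0%R &
  forall x, unit_group x <-> chi x <> 0%R.
Proof.
have [r [rho [v [c [chi [[rho1 rhoM] vM coordE vq chiE]]]]]] :=
  matrix_representation.
have rho_inj x y : rho x *m v 1 = rho y *m v 1 -> x = y.
  by rewrite -!vM !mulg1 => vxy; apply: coord_eq => i; rewrite !coordE vxy.
exists chi; first by apply/eqP; rewrite -chiE rho1 unitmx1.
move=> x; split=> [[y [xy yx]]|/eqP].
  apply/eqP; rewrite -chiE; have := rhoM x y.
  by rewrite xy rho1 => /esym/mulmx1_unit[].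
(* Integer powers need matrices of positive size; in size 0, [rho_inj] makes [M] a single point. *)
rewrite -chiE; case: r => [|r] in rho v c rho1 rhoM vM coordE vq chiE rho_inj *.
  move=> _; exists 1; suff -> : x = 1 by rewrite mulg1.
  by apply: rho_inj; rewrite [LHS]flatmx0 [RHS]flatmx0.
set A := rho x => Au; pose eta := \row_i (c i *m A^-1 *m v 1%g)%R ord0 ord0.
have rhoX m : rho (x ^+ m) = (A ^+ m)%R.
  by elim: m => [|m IH]; rewrite ?rho1 // expgS rhoM IH exprS.
have vX m : v (x ^+ m) = (A ^+ m)%R *m v 1 by rewrite -rhoX -vM mulg1.
have coordX m i : iam_coord (x ^+ m) ord0 i = (c i *m (A ^+ m)%R *m v 1) ord0 ord0.
  by rewrite coordE vX mulmxA.
have [Eqs EqsE] := iam_coord_closed M.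
have : range (@iam_coord k M) eta.
  rewrite EqsE => p Sp.
  (* The choice [e = 0] turns the lemma into a statement about the equations [p = 0] of [M]. *)
  have := @invmx_orbit_meval _ _ A (v 1) c 0%R p Au.
  rewrite !mul0mx mxE /= => pA; rewrite -[RHS]pA.
    by apply: meval_eq => i; rewrite mxE.
  move=> m; rewrite !mul0mx mxE.
  have : range (@iam_coord k M) (iam_coord (x ^+ m)) by exists (x ^+ m).
  rewrite EqsE => /(_ p Sp) <-; apply: meval_eq => i.
  by rewrite coordX.
move=> [y _ yE]; exists y.
(* The entries of [v] are polynomial in the coordinates, so their formula along the powers of [x]
   also extends to the exponent -1; here [e] is a unit row vector. *)
have vy : v y = A^-1%R *m v 1.
  apply/colP => a; have [q qE] := vq a.
  have /asboolP[p pE] := kM_funP q.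
  rewrite qE pE yE.
  have <- : p.@[fun i => (c i *m A^-1 *m v 1%g)%R ord0 ord0] = p.@[eta ord0].
    by apply: meval_eq => i; rewrite [RHS]mxE.
  rewrite (@invmx_orbit_meval _ _ A (v 1) c (delta_mx ord0 a) p Au).
    by rewrite -mulmxA -rowE mxE.
  move=> m; rewrite -mulmxA -vX -rowE mxE qE pE.
  by apply: meval_eq => i; rewrite coordX.
have AV : A *m A^-1%R = 1%:M by exact: mulmxV.
have xy : x * y = 1.
  by apply: rho_inj; rewrite rhoM rho1 -mulmxA -vM mulg1 vy mulmxA AV.
split=> //; apply: rho_inj; rewrite rhoM rho1.
by rewrite (mulmx1C (_ : A *m rho y = 1%:M)) // -rhoM xy.
Qed.

(** One-sided inverses of square matrices are two-sided, and [rho] determines a point through its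
    action on [v 1]. *)
Lemma right_inverse_left (x y : M) : x * y = 1 -> y * x = 1.
Proof.
have [r [rho [v [c [chi [[rho1 rhoM] vM coordE _ _]]]]]] :=
  matrix_representation.
move=> /(congr1 rho); rewrite rhoM rho1 => /mulmx1C yx.
apply: coord_eq => i.
by rewrite !coordE -[y * x]mulg1 vM rhoM yx mul1mx.
Qed.

(** With its mirror image below, this makes the non-units stable under multiplication on either
    side. *)
Lemma unit_groupMl (x y : M) : unit_group (x * y) -> unit_group x.
Proof.
move=> [z [xyz _]]; exists (y * z); rewrite -mulgA in xyz.
by split=> //; exact: right_inverse_left.
Qed.

Lemma unit_groupMr (x y : M) : unit_group (x * y) -> unit_group y.
Proof.
move=> [z [_ zxy]]; exists (z * x); rewrite mulgA in zxy.
by split=> //; exact: right_inverse_left.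
Qed.

End UnitGroup.

Local Notation "x %:F" := (@FracField.tofrac _ x).

(** * Invariant rational functions and observability *)

Section InvariantFractions.
Variables (k : closedFieldType) (M : irr_affine_monoid k) (H : set M).
Implicit Types (x : M) (f : kM M) (z : {fraction kM M}).

Lemma frac_quotient z : exists a b : kM M, b != 0 /\ z = a%:F / b%:F.
Proof.
exists \n_(repr z), \d_(repr z); split; first exact: denom_ratioP.
exact: frac_reprE.
Qed.

Lemma translate_eq0 x f : unit_group x -> (translate x f == 0) = (f == 0).
Proof.
move=> Gx; rewrite -(inj_eq (translate_inj Gx) f).
by rewrite (rmorph0 (translate x)).
Qed.

Lemma frac_translate_tofrac x f : unit_group x ->
  frac_translate x f%:F = (translate x f)%:F.
Proof.
move=> Gx; rewrite -[f%:F]divr1 -tofrac1 frac_translateE ?oner_neq0 //.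
by rewrite (rmorph1 (translate x)) tofrac1 divr1.
Qed.

Lemma frac_translate_div x z w : unit_group x ->
  frac_translate x (z / w) = frac_translate x z / frac_translate x w.
Proof.
move=> Gx; have [a [b [b0 ->]]] := frac_quotient z.
have [c [d [d0 ->]]] := frac_quotient w.
rewrite !frac_translateE // !invf_div !mulf_div -!tofracM.
(* If [w] is 0, both sides are 0 by the convention that the inverse of 0 is 0. *)
have [->|c0] := eqVneq c 0.
  rewrite (rmorph0 (translate x)) !mulr0 tofrac0 !invr0 !mulr0.
  by rewrite -tofrac0 frac_translate_tofrac // (rmorph0 (translate x)).
by rewrite frac_translateE ?mulf_neq0 // !translateM.
Qed.

Lemma frac_translateM x z w : unit_group x ->
  frac_translate x (z * w) = frac_translate x z * frac_translate x w.
Proof.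
move=> Gx; have ft1 : frac_translate x 1 = 1 :> {fraction kM M}.
  by rewrite -tofrac1 frac_translate_tofrac // (rmorph1 (translate x)).
by rewrite -{1}[w]invrK -[w^-1]div1r !frac_translate_div // ft1 div1r invrK.
Qed.

Lemma kG_tofrac f : kG f%:F.
Proof.
move=> x _; exists f, 1; split; last by rewrite tofrac1 divr1.
by apply/eqP; exact: oner_neq0.
Qed.

Lemma fractions_kG : fractions (@kG k M) = setT.
Proof.
apply/seteqP; split=> // z _; have [a [b [b0 ->]]] := frac_quotient z.
exists a%:F, b%:F; split => //; try exact: kG_tofrac.
by apply/eqP; rewrite tofrac_eq0.
Qed.

Hypothesis HG : H `<=` @unit_group k M.

Lemma kM_inv_kG_inv f : kM_inv_ring H f -> kG_inv_ring H f%:F.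
Proof.
move=> [_ fH]; split=> [|x Hx]; first exact: kG_tofrac.
by rewrite frac_translate_tofrac ?fH //; exact: HG.
Qed.

Lemma fractions_kM_inv_sub :
  fractions (@FracField.tofrac (kM M) @` kM_inv_ring H) `<=`
    fractions (kG_inv_ring H).
Proof.
move=> z [_ [_ [[a aI <-] [b bI <-] b0 ->]]].
by exists a%:F, b%:F; split=> //; exact: kM_inv_kG_inv.
Qed.

Lemma fractions_kG_inv_sub :
  fractions (kG_inv_ring H) `<=` invariants setT (@frac_translate k M) H.
Proof.
move=> z [a [b [[_ aI] [_ bI] _ ->]]]; split=> // x Hx.
by rewrite frac_translate_div ?aI ?bI //; exact: HG.
Qed.

(** The denominators of [z] form an ideal, which is [H]-stable because [z] is invariant. An
    invariant denominator forces an invariant numerator. *)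
Lemma invariant_frac z : observable_in_M H ->
  invariants setT (@frac_translate k M) H z ->
  fractions (@FracField.tofrac (kM M) @` kM_inv_ring H) z.
Proof.
move=> obs [_ zH].
pose I : set (kM M) := [set d | exists a, d%:F * z = a%:F].
have [|||d [[a az] /eqP d0 dH]] := obs I.
- split=> //.
  + by exists 0; rewrite tofrac0 mul0r.
  + move=> f g [a fa] [b gb]; exists (a + b).
    by rewrite !tofracD mulrDl fa gb.
  + by move=> f g _ [a ga]; exists (f * a); rewrite !tofracM -mulrA ga.
- move=> x f Hx [a fa]; exists (translate x a).
  have Gx := HG Hx; have [f0|f0] := eqVneq f 0.
    move: fa; rewrite f0 tofrac0 mul0r => /esym/eqP; rewrite tofrac_eq0 => /eqP ->.
    by rewrite (rmorph0 (translate x)) tofrac0 mul0r.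
  have zE : z = a%:F / f%:F by rewrite -fa mulrC mulKf // tofrac_eq0.
  have fx0 : (translate x f)%:F != 0 by rewrite tofrac_eq0 translate_eq0.
  by rewrite -(zH x Hx) zE frac_translateE // mulrCA mulfV ?mulr1.
- have [a [b [b0 zE]]] := frac_quotient z.
  exists b; last by apply/eqP.
  by exists a; rewrite zE mulrCA mulfV ?mulr1 // tofrac_eq0.
have zE : z = a%:F / d%:F by rewrite -az mulrC mulKf // tofrac_eq0.
exists a%:F, d%:F; split=> //; last by apply/eqP; rewrite tofrac_eq0.
  exists a => //; split=> // x Hx; apply/eqP; rewrite -tofrac_eq.
  rewrite -frac_translate_tofrac; last exact: HG.
  rewrite -az frac_translateM ?zH ?frac_translate_tofrac ?dH //; exact: HG.
by exists d.
Qed.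

(** Clearing the denominator of a nonzero element of [I] shows that the contraction of [I] to [k[M]]
    is nonzero. *)
Lemma observable_M_G : observable_in_M H -> observable_in_G H.
Proof.
move=> obs I [IG I0 ID IM] IH [z Iz z0].
pose J : set (kM M) := [set f | I f%:F].
have [|||f [Jf f0 fH]] := obs J.
- split=> //.
  + by move=> f g Jf Jg; rewrite /J /mkset tofracD; exact: ID.
  + move=> f g _ Jg; rewrite /J /mkset tofracM.
    by apply: IM => //; exact: kG_tofrac.
- move=> x f Hx Jf; rewrite /J /mkset -frac_translate_tofrac; last exact: HG.
  exact: IH.
- have [a [b [b0 zE]]] := frac_quotient z.
  exists a => [|a0]; last by apply: z0; rewrite zE a0 tofrac0 mul0r.
  rewrite /J /mkset (_ : a%:F = b%:F * z).
    by apply: IM => //; exact: kG_tofrac.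
  by rewrite zE mulrCA mulfV ?mulr1 // tofrac_eq0.
exists f%:F; split=> //.
  by move/eqP; rewrite tofrac_eq0 => /eqP.
by move=> x Hx; rewrite frac_translate_tofrac ?fH //; exact: HG.
Qed.

End InvariantFractions.

(** * Separating [H] from the other units by invariant fractions *)

Section Separation.
Variables (k : closedFieldType) (M : irr_affine_monoid k) (H : set M).
Hypothesis HG : H `<=` @unit_group k M.
Hypothesis H1 : H 1%g.
Hypothesis HM : forall x y, H x -> H y -> H (x * y)%g.

(* The left translates of f by H span a finite-dimensional H-stable space with
   basis u, and D is a matrix of right translates of u. Both are multiplied by
   the same matrix under the action of H, so that D^-1 u is H-invariant. If x
   fixes D^-1 u, which vanishes at 1, then u vanishes at x. *)
Lemma invariant_frac_separation (f : kM M) (x : M) :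
  (forall y, H y -> f y = 0) -> unit_group x ->
  (forall z, invariants setT (@frac_translate k M) H z ->
     frac_translate x z = z) ->
  f x = 0.
Proof.
move=> fH Gx xz.
pose F (h : {y | H y}) (m : M) : k := f (sval h * m)%g.
have [r [s [t [D0u basis]]]] : exists r (s : 'I_r -> {y | H y}) (t : 'I_r -> M),
    kernel_mx F s t \in unitmx /\
    forall x y, F x y = (kernel_mx F (fun _ : 'I_1 => x) t *m
      invmx (kernel_mx F s t) *m kernel_mx F s (fun _ : 'I_1 => y)) ord0 ord0.
  exact/finite_rank_basis/(finite_rank_comp _ (finite_rank_kM f)).
set D0 := kernel_mx F s t in D0u basis.
pose D : 'M[kM M]_r :=
  \matrix_(i, j) rtranslate (t j) (translate (sval (s i)) f).
pose u : 'cV[kM M]_r := \col_i translate (sval (s i)) f.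
pose Delta := \det D.
(* Cramer's rule: [N / Delta] is [D^-1 u], with numerators and denominator in [k[M]]. *)
have [N NDef] : exists N, N = \adj D *m u by exists (\adj D *m u).
have D1 : map_mx (kM_eval 1%g) D = D0.
  by apply/matrixP => i j; rewrite !mxE /kM_eval /F /= mul1g.
have u1 : map_mx (kM_eval 1%g) u = 0.
  by apply/matrixP => i j; rewrite !mxE /kM_eval /= mulg1 fH //; exact: svalP.
have Delta1 : Delta 1%g != 0.
  have -> : Delta 1%g = \det D0 by rewrite -D1 det_map_mx.
  by rewrite -unitfE -unitmxE.
have Delta0 : Delta != 0.
  by apply: contraNneq Delta1 => ->.
(* For [y] in [H] the elements [s i * y] stay in [H], so the reconstruction formula expresses the
   new rows in the basis with constant coefficients. *)
have stable y : H y -> exists rho : 'M[k]_r, forall m,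
    map_mx (kM_eval m) (map_mx (translate y) D) = rho *m map_mx (kM_eval m) D /\
    map_mx (kM_eval m) (map_mx (translate y) u) = rho *m map_mx (kM_eval m) u.
  move=> Hy; pose sy i : {y | H y} := exist _ _ (HM (svalP (s i)) Hy).
  exists (kernel_mx F sy t *m invmx D0) => m.
  have FE i w : F (sy i) w =
      (kernel_mx F sy t *m invmx D0 *m kernel_mx F s (fun _ : 'I_1 => w)) i ord0.
    rewrite basis mxE [RHS]mxE; apply: eq_bigr => l _; congr (_ * _)%R.
    by rewrite !mxE; apply: eq_bigr => l' _; rewrite !mxE.
  split; apply/matrixP => i j.
    transitivity (F (sy i) (m * t j)%g).
      by rewrite !mxE /F /kM_eval /= !mulgA.
    rewrite FE !mxE; apply: eq_bigr => l _; congr (_ * _).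
    by rewrite !mxE.
  transitivity (F (sy i) m); first by rewrite !mxE /F /kM_eval /= !mulgA.
  by rewrite FE !mxE; apply: eq_bigr => l _; congr (_ * _); rewrite !mxE.
(* The common factor [rho] is pulled out on the left, and [D *m \adj D] is the scalar [Delta]. *)
have DN y : H y -> map_mx (translate y) D *m N = Delta *: map_mx (translate y) u.
  move=> /stable[rho rhoE]; apply/colP => i; apply: kM_eqP => m.
  have [DE uE] := rhoE m.
  suff : map_mx (kM_eval m) (map_mx (translate y) D *m N) =
         map_mx (kM_eval m) (Delta *: map_mx (translate y) u).
    by move/matrixP/(_ i ord0); rewrite !mxE.
  rewrite map_mxZ map_mxM NDef map_mxM map_mx_adj DE uE -mulmxA.
  rewrite [X in rho *m X]mulmxA mul_mx_adj mul_scalar_mx -scalemxAr.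
  by rewrite det_map_mx.
have NE y : map_mx (translate y) N =
    \adj (map_mx (translate y) D) *m map_mx (translate y) u.
  by rewrite NDef map_mxM map_mx_adj.
have DeltaE y : translate y Delta = \det (map_mx (translate y) D).
  by rewrite det_map_mx.
pose z j := (N j ord0)%:F / Delta%:F.
have ztE y j : unit_group y -> (frac_translate y (z j) = z j) <->
    translate y Delta * N j ord0 = Delta * translate y (N j ord0).
  move=> Gy; rewrite frac_translateE //; split=> [/eqP|E].
    rewrite eqr_div ?tofrac_eq0 ?translate_eq0 // -!tofracM tofrac_eq.
    by move=> /eqP; rewrite mulrC [RHS]mulrC => ->.
  apply/eqP; rewrite eqr_div ?tofrac_eq0 ?translate_eq0 // -!tofracM tofrac_eq.
  by rewrite mulrC -E mulrC.
have zI j : invariants setT (@frac_translate k M) H (z j).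
  split=> // y Hy; apply/ztE; first exact: HG.
  have : translate y Delta *: N = Delta *: map_mx (translate y) N.
    by rewrite NE [RHS]scalemxAr -DN // mulmxA mul_adj_mx -DeltaE mul_scalar_mx.
  by move/matrixP/(_ j ord0); rewrite !mxE.
have xN : translate x Delta *: N = Delta *: map_mx (translate x) N.
  by apply/colP => j; rewrite !mxE; apply/ztE => //; exact: xz.
(* For [x] the argument runs backwards: invariance is now given, and the nonzero factor
   [translate x Delta] is cancelled. *)
have DxN : map_mx (translate x) D *m N = Delta *: map_mx (translate x) u.
  apply: (@scalemx_inj _ _ _ (translate x Delta)); first by rewrite translate_eq0.
  rewrite scalemxAr xN -scalemxAr NE mulmxA mul_mx_adj -DeltaE mul_scalar_mx.
  by rewrite !scalerA mulrC.
(* At 1, [N] vanishes along with [u] while [Delta] does not, so [u] vanishes at [x]. *)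
have ux0 i : F (s i) x = 0.
  move/(congr1 (map_mx (kM_eval 1%g))): DxN.
  rewrite map_mxM NDef map_mxM u1 !mulmx0 map_mxZ => /esym/matrixP/(_ i ord0).
  rewrite !mxE => /eqP; rewrite mulf_eq0 (negPf Delta1) /= => /eqP.
  by rewrite /kM_eval /= mulg1.
(* As 1 lies in [H], [f] itself is in the span of [u]. *)
have -> : f x = F (exist _ _ H1) x by rewrite /F /= mul1g.
rewrite basis mxE big1 // => l _.
by rewrite [X in _ * X]mxE ux0 mulr0.
Qed.

End Separation.

(** * The fixer of the invariants in [M] *)

Section Fixer.
Variables (k : closedFieldType) (M : irr_affine_monoid k) (H : set M).

(** For fixed [f] and [m], the condition [f (x * m) = f m] is polynomial in [x], because right
    translates of [f] are regular. *)
Lemma zariski_closed_fixer (A : set (kM M)) :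
  zariski_closed (@iam_coord k M) [set x | forall f, A f -> translate x f = f].
Proof.
exists [set p | exists f m, A f /\
  forall x : M, p.@[iam_coord x ord0] = f (x * m)%g - f m].
apply/seteqP; split=> x /= xA.
  move=> p [f [m [Af ->]]].
  by rewrite -[f (x * m)%g]/(translate x f m) xA // subrr.
move=> f Af; apply: kM_eqP => m /=.
have /asboolP[p pE] := kM_funP (rtranslate m f).
apply/eqP; rewrite -subr_eq0; apply/eqP.
rewrite -[f (x * m)%g]/(rtranslate m f x) pE.
rewrite -[X in _ - X](mevalC (iam_coord x ord0)) -mevalB.
apply: xA; exists f, m; split=> // y.
by rewrite mevalB mevalC -pE.
Qed.

Hypothesis HG : H `<=` @unit_group k M.
Hypothesis obs : observable_in_M H.

Lemma fixer_unit (x : M) :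
  (forall f, kM_inv_ring H f -> translate x f = f) -> unit_group x.
Proof.
move=> xI; pose I : set (kM M) := [set f | forall m, ~ unit_group m -> f m = 0].
have [|||f [If /kM_neq0P[m fm] fH]] := obs (I := I).
- split=> // [f g If Ig m nm|f g _ Ig m nm].
    by rewrite -[LHS]/(f m + g m) If // Ig // addr0.
  by rewrite -[LHS]/(f m * g m) Ig // mulr0.
- by move=> y f Hy If m nm; apply: If => /unit_groupMr.
(* [chi] vanishes exactly at the non-units, so the ideal is nonzero. *)
- have [chi chi1 chiE] := unit_group_open M.
  exists chi => [m nm|chi0]; last by apply: chi1; rewrite chi0.
  by apply: contrapT => /chiE.
apply: (@unit_groupMl _ _ x m); apply: contrapT => /If xm0; apply: fm.
by rewrite -xm0 -[f (x * m)%g]/(translate x f m) xI.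
Qed.

Lemma fixer_frac (x : M) : unit_group x ->
  (forall f, kM_inv_ring H f -> translate x f = f) ->
  forall z, invariants setT (@frac_translate k M) H z -> frac_translate x z = z.
Proof.
move=> Gx xI z /(invariant_frac HG obs)[_ [_ [[a aI <-] [b bI <-] b0 ->]]].
rewrite frac_translateE ?xI //.
by apply: contra_notN b0 => /eqP ->; exact: tofrac0.
Qed.

End Fixer.

(** The fixer in [M] is all of [H]. An irreducible component can equal [H] only if [H] is
    irreducible, whence the premise of the last clause. *)
Theorem theorem3p3 (k : closedFieldType) (M : irr_affine_monoid k)
    (H : set M) :
  closed_subgroup H -> observable_in_M H ->
  [/\ observable_in_G H,
      zariski_closed (@iam_coord k M) H,
      [/\ invariants setT (@frac_translate k M) H =
            invariants (fractions (@kG k M)) (@frac_translate k M) H,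
          invariants (fractions (@kG k M)) (@frac_translate k M) H =
            fractions (kG_inv_ring H) &
          fractions (kG_inv_ring H) =
            fractions (@FracField.tofrac (kM M) @` kM_inv_ring H)] &
      [/\ H = [set x | unit_group x /\
                 forall z, kG_inv_ring H z -> frac_translate x z = z],
          H = [set x | unit_group x /\
                 forall f, kM_inv_ring H f -> translate x f = f],
          H = [set x | forall f, kM_inv_ring H f -> translate x f = f] &
          irreducible_set (@iam_coord k M) H ->
          unique_component_at (@iam_coord k M) 1%g
            [set x | forall f, kM_inv_ring H f -> translate x f = f] H]].
Proof.
move=> [HG H1 HM _ [Z [S ZE] HE]] obs.
have fixE : H = [set x | forall f, kM_inv_ring H f -> translate x f = f].
  apply/seteqP; split=> [x Hx f [_ fH]|x xI]; first exact: fH.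
  have Gx := fixer_unit obs xI.
  (* Each equation of [Z] gives a regular function vanishing on [H], to which the separation lemma
     applies. *)
  rewrite HE; split=> //; rewrite ZE => p Sp.
  have [f fE] := kM_of_poly (M := M) p; rewrite -fE.
  apply: (invariant_frac_separation HG H1 HM) => //.
    by move=> y; rewrite HE ZE => -[_ /(_ p Sp)]; rewrite fE.
  exact: fixer_frac.
have fixGE : H = [set x | unit_group x /\
    forall f, kM_inv_ring H f -> translate x f = f].
  apply/seteqP; split=> [x Hx|x [_ xI]]; last by rewrite fixE.
  by split; [exact: HG | move: Hx; rewrite {1}fixE].
(* The inclusions close up into a cycle through the field of invariant rational functions. *)
have fracE : fractions (kG_inv_ring H) =
    fractions (@FracField.tofrac (kM M) @` kM_inv_ring H).
  apply/seteqP; split; last exact: fractions_kM_inv_sub.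
  by move=> z /(fractions_kG_inv_sub HG); exact: invariant_frac.
split.
- exact: observable_M_G.
- by rewrite fixE; exact: zariski_closed_fixer.
- rewrite fractions_kG; split=> //; rewrite fracE; apply/seteqP; split=> z.
    exact: invariant_frac.
  by rewrite -fracE; exact: fractions_kG_inv_sub.
- split=> //; last first.
    rewrite -fixE => Hirr; split=> // [|D [DH Dirr Dmax] _].
      split=> // D DH Dirr HD; exact/seteqP.
    by rewrite -(Dmax H).
  apply/seteqP; split=> [x Hx|x [Gx xI]].
    by split=> [|z [_ zH]]; [exact: HG | exact: zH].
  rewrite fixGE; split=> // f fI.
  have := xI _ (kM_inv_kG_inv HG fI); rewrite frac_translate_tofrac //.
  by move/eqP; rewrite tofrac_eq => /eqP.
Qed.
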